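(* Let $G=(V,E)$ be a connected simple graph with a fixed total order on $E$ (and a fixed root vertex), and let $m\ge 2$. There exists an acyclic matching on the Hasse diagram of the NBC chromatic complex $C_{\mathrm{NBC}}(G)$ over $\mathcal{A}_m$ such that, for every NBC spanning tree $T$ of $G$, exactly $m(m-1)^{|C(\mathrm{IN}(T))|-1}$ critical basis elements $(H,\epsilon)$ satisfy $\mathrm{IN}(T)\subseteq E(H)\subseteq E(T)$, where $|C(\mathrm{IN}(T))|$ is the number of connected components of the spanning subgraph $(V,\mathrm{IN}(T))$.
   Context: $\mathcal{A}_m=\mathbb{Z}[x]/(x^m)$. An enhanced state is $(H,\epsilon)$ with $H$ a spanning subgraph of $G$ and $\epsilon$ assigning to each component of $H$ an element of $\{1,x,\dots,x^{m-1}\}$. The chromatic differential is $d(H,\epsilon)=\sum_{e\notin E(H)}(-1)^{\#\{e'\in E(H):e'<e\}}(H\cup e,\epsilon_e)$, where if $e$ merges components $C_1,C_2$ the merged component gets $\epsilon(C_1)\epsilon(C_2)\in\mathcal{A}_m$ (term zero if the product is $0$) and otherwise $\epsilon_e=\epsilon$. A broken circuit is the edge set of a cycle minus its smallest edge; an edge set is NBC if it contains no broken circuit; an NBC spanning tree is a spanning tree with NBC edge set. $C_{\mathrm{NBC}}(G)$ is the free abelian group on enhanced states with NBC edge set, with differential obtained from $d$ by discarding terms whose edge set is not NBC. For a spanning tree $T$ and $e\in E(T)$, $\mathrm{cut}(T,e)$ is the set of edges of $G$ joining the two components of $T-e$; $e$ is internally inactive if it is not the smallest edge of $\mathrm{cut}(T,e)$,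 and $\mathrm{IN}(T)$ is the set of internally inactive edges. Hasse diagram: directed graph on the basis with $c\to c'$ whenever the coefficient of $c'$ in $\partial c$ is nonzero. A matching is a set of such edges no two sharing a vertex; it is acyclic if matched coefficients are invertible and reversing the matched edges yields no directed cycle; critical elements are unmatched basis elements. *)

(* Defs.v *)
From HB Require Import structures.
From mathcomp Require Import all_boot all_order all_algebra.
Set Implicit Arguments.
Unset Strict Implicit.
Unset Printing Implicit Defensive.
Import Order.TTheory GRing.Theory.
Local Open Scope ring_scope.

Section Graph.
(* A graph with edge set E, totally ordered; ends e is the set of endpoints of
   e. Edge sets of spanning subgraphs are exactly the elements of {set E}. *)
Variables (V : finType) (disp : Order.disp_t) (E : finOrderType disp).
Variable ends : E -> {set V}.
Implicit Types (H T Z B : {set E}) (e f : E).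

Definition simple_graph : Prop :=
  injective ends /\ forall e, #|ends e| = 2.

Definition adj H : rel V :=
  [rel u v | [exists e in H, ends e == [set u; v]]].

Definition connected_subgraph H : bool :=
  [forall u, forall v, connect (adj H) u v].

Definition comps H : {set {set V}} :=
  [set [set v | connect (adj H) u v] | u : V].

(* A cycle is given by its sequence of vertices, which are pairwise distinct;
   the bound on its length makes the quantification finite. *)
Definition is_cycle Z : bool :=
  [exists n : 'I_#|V|.+1, exists p : n.-tuple V,
    [&& (2 < n)%N, uniq p, cycle (adj [set: E]) p &
        Z == [set e | [exists x in p, ends e == [set x; next p x]]]]].

Definition broken_circuit B : bool :=
  [exists Z, is_cycle Z &&
    [exists e in Z, [forall f in Z, (e <= f)%O] && (B == Z :\ e)]].

Definition nbc H : bool :=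
  ~~ [exists B, broken_circuit B && (B \subset H)].

Definition spanning_tree T : bool :=
  connected_subgraph T && ~~ [exists Z, is_cycle Z && (Z \subset T)].

Definition nbc_spanning_tree T : bool := spanning_tree T && nbc T.

Definition cut T e : {set E} :=
  [set f | [exists u, exists v,
     (ends f == [set u; v]) && ~~ connect (adj (T :\ e)) u v]].

Definition internally_inactive T e : bool :=
  ~~ [forall f in cut T e, (e <= f)%O].

Definition IN T : {set E} := [set e in T | internally_inactive T e].

Section ChromaticComplex.
Variable m : nat.

(* The ring Z[x]/(x^m); the library quotient is the intended one for m >= 1. *)
Definition Am := {poly %/ ('X^m : {poly int})}.

Definition xpow (k : nat) : Am := 'qX ^+ k.

Definition component H := {C : {set V} | C \in comps H}.

(* The label k of a component stands for the element x^k of Am. *)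
Definition state := {H : {set E} & {ffun component H -> 'I_m}}.

Definition sub_of (s : state) : {set E} := tag s.
Definition eps_of (s : state) : {ffun component (sub_of s) -> 'I_m} := tagged s.

(* The labelling eps_e of the components of H + e: a component of H + e is
   either a component of H, and the product has a single factor, or the union
   of the two components C1, C2 of H merged by e, and the product is
   eps(C1) * eps(C2), taken in Am. *)
Definition merged_label (s : state) e (C : component (e |: sub_of s)) : Am :=
  \prod_(C0 : component (sub_of s) | val C0 \subset val C) xpow (eps_of s C0).

(* The element (H + e, eps_e) of the free abelian group {ffun state -> int}.
   As x^k != 0 for k < m, it is 0 when some label of eps_e is 0 in Am. *)
Definition enhanced_term (s : state) e : {ffun state -> int} :=
  [ffun t : state =>
    [exists l : {ffun component (e |: sub_of s) -> 'I_m},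
      (t == Tagged (fun H => {ffun component H -> 'I_m}) l) &&
      [forall C, xpow (l C) == merged_label C]]%:R].

Definition chromatic_diff (s : state) : {ffun state -> int} :=
  \sum_(e | e \notin sub_of s)
     enhanced_term s e *~ ((-1) ^+ #|[set f in sub_of s | (f < e)%O]|).

Definition nbc_state := {s : state | nbc (sub_of s)}.

Definition nbc_diff (s : nbc_state) : {ffun nbc_state -> int} :=
  [ffun t : nbc_state => chromatic_diff (val s) (val t)].

End ChromaticComplex.
End Graph.

Section Matching.
(* Based complex over the integers, with basis S and differential d. *)
Variables (S : finType) (d : S -> {ffun S -> int}).
Implicit Types M : {set S * S}.

Definition hasse : rel S := [rel a b | d a b != 0].

Definition is_matching M : Prop :=
  (forall p, p \in M -> hasse p.1 p.2) /\
  (forall p q, p \in M -> q \in M -> p != q ->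
     [disjoint [set p.1; p.2] & [set q.1; q.2]]).

Definition reversed_hasse M : rel S :=
  [rel a b | (hasse a b && ((a, b) \notin M)) || ((b, a) \in M)].

Definition acyclic_matching M : Prop :=
  [/\ is_matching M,
      forall p, p \in M -> d p.1 p.2 \is a GRing.unit
    & forall c : seq S, c != [::] -> ~~ cycle (reversed_hasse M) c].

Definition critical M (s : S) : bool :=
  [forall p in M, (s != p.1) && (s != p.2)].

End Matching.

(* Main.v *)
Require Import Defs.
From mathcomp Require Import all_boot all_order all_algebra zify.

(* An NBC set H is contained in a unique spanning tree T(H) all of whose edges
   outside H are internally active, namely the connected set of least weight
   containing H; hence the NBC sets are partitioned into the intervals
   [IN(T), T], and T(H) can only become heavier when an edge is added to H.
   Inside an interval the complex is the chromatic complex of the rooted tree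
   T / IN(T).  Its edges are scanned from the leaves to the root, and a state is
   matched along the first edge e that either lies in H or whose lower endpoint
   lies in a component labelled 1: e is removed, the lower component receiving
   the label 1, respectively added.  An unmatched state has H = IN(T), and only
   the component of the root may be labelled 1, which leaves m labels for that
   component and m - 1 for each of the others. *)

Set Implicit Arguments.
Unset Strict Implicit.
Unset Printing Implicit Defensive.

Import GRing.Theory.

(** * Connectivity and cycles *)

Section Connectivity.
Variables (V : finType) (disp : Order.disp_t) (E : finOrderType disp).
Variable ends : E -> {set V}.
Hypothesis hsimple : simple_graph ends.
Implicit Types (H T Z B A F : {set E}) (e f g : E) (u v x y : V).

Local Notation conn H := (connect (adj ends H)).

Lemma set2_eq (a b c d : V) :
  [set a; b] = [set c; d] -> (a = c /\ b = d) \/ (a = d /\ b = c).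
Proof.
move=> eqS; have a_cd : a \in [set c; d] by rewrite -eqS set21.
have b_cd : b \in [set c; d] by rewrite -eqS set22.
have: d \in [set a; b] by rewrite eqS set22.
have: c \in [set a; b] by rewrite eqS set21.
move: a_cd b_cd; rewrite !inE.
do 4![case/orP=> /eqP ?]; subst; by [left | right].
Qed.

Lemma adjP H u v : reflect (exists2 e, e \in H & ends e = [set u; v]) (adj ends H u v).
Proof.
apply: (iffP existsP) => [[e /andP[eH /eqP ee]] | [e eH ee]]; exists e => //.
by rewrite eH ee eqxx.
Qed.

Lemma adj_sym H : symmetric (adj ends H).
Proof. by move=> u v; apply/adjP/adjP => -[e eH ee]; exists e; rewrite // setUC. Qed.

Lemma conn_sym H : connect_sym (adj ends H).
Proof. exact: sym_connect_sym (@adj_sym H). Qed.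

Lemma connS H A u v : H \subset A -> conn H u v -> conn A u v.
Proof.
move=> sHA; apply: connect_sub => a b /adjP[e eH ee]; apply: connect1.
by apply/adjP; exists e => //; apply: (subsetP sHA).
Qed.

Lemma conn_ends H e x y : e \in H -> ends e = [set x; y] -> conn H x y.
Proof. by move=> eH ee; apply/connect1/adjP; exists e. Qed.

Lemma conn_rect (P : V -> Prop) H u v : conn H u v -> P u ->
  (forall a b e, e \in H -> ends e = [set a; b] -> P a -> P b) -> P v.
Proof.
case/connectP=> p; elim: p u => [|w p IH] u /=; first by move=> _ ->.
case/andP=> /adjP[e eH ee] pp vE Pu step; exact: (IH w pp vE (step _ _ _ eH ee Pu) step).
Qed.

Lemma ends_neq e x y : ends e = [set x; y] -> x != y.
Proof. by case: hsimple => _ /(_ e) + ee; rewrite ee cards2; case: (x != y). Qed.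

Lemma ends_pair e : exists x y, ends e = [set x; y].
Proof. by case: hsimple => _ /(_ e) /eqP /cards2P[x [y [_ ee]]]; exists x, y. Qed.

(** A walk is cut at its passages through [e]: the right-hand side, as a predicate of [v], is
    preserved by each step of a walk in [e |: H]. *)
Lemma conn_setU1 e x y H u v : ends e = [set x; y] ->
  conn (e |: H) u v =
  [|| conn H u v, conn H u x && conn H y v | conn H u y && conn H x v].
Proof.
move=> ee; have sH : H \subset e |: H by apply: subsetUr.
have cxy : conn (e |: H) x y by apply: conn_ends ee; rewrite setU11.
apply/idP/idP => [cuv|].
  apply: (conn_rect (P := fun v => [|| conn H u v, conn H u x && conn H y v
    | conn H u y && conn H x v]) cuv); first by rewrite connect0.
  move=> a b f; case/setU1P=> [-> | fH fe].
    rewrite ee => /set2_eq[] [<- <-] /or3P[c|/andP[c c']|/andP[c c']];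
      rewrite ?connect0 ?c ?orbT //=.
  have cab := conn_ends fH fe.
  by case/or3P=> [c|/andP[-> c]|/andP[-> c]]; rewrite (connect_trans c cab) ?orbT.
case/or3P=> [|/andP[/(connS sH) c1 /(connS sH) c2]|/andP[/(connS sH) c1 /(connS sH) c2]].
- exact: connS.
- exact: connect_trans c1 (connect_trans cxy c2).
- by rewrite conn_sym in cxy; exact: connect_trans c1 (connect_trans cxy c2).
Qed.

(** Acyclicity phrased as every edge being a bridge, so that trees are handled by connectivity
    alone. *)
Definition forest H : Prop :=
  forall e x y, e \in H -> ends e = [set x; y] -> ~~ conn (H :\ e) x y.

(* The vertices reached from [u] without [F], together with those cut off from
   [u] by an edge of [F] at the rim, form a union of components of [T]. *)
Lemma forest_separating_edge T F u v : forest T -> conn T u v ->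
  ~~ conn (T :\: F) u v ->
  exists g x, [/\ g \in T, g \in F, x \in ends g, conn (T :\: F) u x
    & ~~ conn (T :\ g) u v].
Proof.
move=> fT cuv ncuv.
have DF g : g \in F -> T :\: F \subset T :\ g.
  by move=> gF; apply: setDS; rewrite sub1set.
pose P w := conn (T :\: F) u w \/ exists g x, [/\ g \in T, g \in F, x \in ends g,
  conn (T :\: F) u x & ~~ conn (T :\ g) u w].
suff [c|//] : P v by rewrite c in ncuv.
apply: (conn_rect (P := P) cuv); first by left; rewrite connect0.
move=> a b h hT he [ca|[g [x [gT gF xg cx nc]]]].
- have [hF|hF] := boolP (h \in F); last first.
    by left; apply: connect_trans ca (conn_ends _ he); rewrite inE hF.
  right; exists h, a; split=> //; first by rewrite he set21.
  apply: contra (fT h a b hT he) => cb.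
  by apply: connect_trans cb; rewrite conn_sym (connS (DF _ hF)).
- have [hg|hg] := eqVneq h g.
    subst h; move: xg; rewrite he !inE => /orP[/eqP xa|/eqP <-]; last by left.
    by subst a; rewrite (connS (DF _ gF) cx) in nc.
  right; exists g, x; split=> //; apply: contra nc => cb.
  apply: connect_trans cb _; rewrite conn_sym; apply: conn_ends he.
  by rewrite !inE hg.
Qed.

Lemma cycle_conn Z g u v : is_cycle ends Z -> g \in Z -> ends g = [set u; v] ->
  conn (Z :\ g) u v.
Proof.
case/existsP=> n /existsP[p /and4P[n2 up cp /eqP->]].
rewrite !inE => /existsP[x /andP[xp /eqP ge]] ge'.
set Z' := _ :\ g; suff cx : conn Z' (next p x) x.
  by move: ge'; rewrite ge => /set2_eq[] [<- <-] //; rewrite conn_sym.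
have szp : size p = n by rewrite size_tuple.
have [i q def] := rot_to xp.
have nE := next_rot i up; have uq : uniq (x :: q) by rewrite -def rot_uniq.
have cq : cycle (adj ends setT) (x :: q) by rewrite -def rot_cycle.
have mq : (x :: q) =i p by move=> z; rewrite -def mem_rot.
have szq : size (x :: q) = n by rewrite -def size_rot.
have fq := cycle_next uq.
rewrite def in nE; case: q {def} => [|y [|z q]] in nE uq cq mq szq fq *;
  rewrite ?szp -?szq in n2 => //.
have nxy : next p x = y by rewrite -nE /= eqxx.
move: uq => /= /and3P[]; rewrite !inE !negb_or => /and3P[xy xz xq] /andP[yz yq] uq.
have nyz : next p y = z by rewrite -nE /= eq_sym (negPf xy) eqxx.
(* Such a step cannot use [g], whose ends are [x] and [y]: as [a] differs from [x], it would lead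
   from [y] back to [x], whereas the successor of [y] is [z]. This is where a length of at least
   three counts. *)
have step a b : a \in [:: y, z & q] -> adj ends setT a b -> b = next p a ->
    adj ends Z' a b.
  move=> aq /adjP[f _ fe] bE; apply/adjP; exists f => //; rewrite !inE; apply/andP; split.
    apply: contraTneq aq => fg; move: fe; rewrite fg ge nxy => /set2_eq[][xa ya].
      by rewrite -xa !inE !negb_or xy xz.
    by move: xz; rewrite xa bE -ya nyz eqxx.
  by apply/existsP; exists a; rewrite -mq inE aq orbT fe bE eqxx.
rewrite nxy; move: cq fq; rewrite (cycle_path x) (cycle_path x) /=.
case/and3P=> alast axy ayz /and3P[/eqP flast _ fyz].
have ayz' : path (adj ends setT) y (z :: q) by rewrite /= .
have fyz' : path (frel (next [:: x, y, z & q])) y (z :: q) by [].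
have py : path (adj ends Z') y (z :: q).
  have: path (fun a b => adj ends setT a b && (b == next p a)) y (z :: q).
    apply/(pathP x) => k kq; rewrite (pathP x ayz') //= eq_sym -nE.
    exact: (pathP x fyz').
  apply: (sub_in_path (P := mem [:: y, z & q])); last exact/allP.
  by move=> a b aq _ /andP[ab /eqP]; apply: step aq ab.
have ly : last y (z :: q) \in [:: y, z & q] by apply: mem_last.
apply: connect_trans (connect1 (step _ _ ly alast _)).
  by apply/connectP; exists (z :: q).
by rewrite -nE /= flast.
Qed.

(** The cycle is a duplicate-free path from [x] to [y] in [A], closed by [e]; the path has at least
    two edges because a single one would be parallel to [e]. *)
Lemma conn_cycle A e x y : ends e = [set x; y] -> e \notin A -> conn A x y ->
  exists Z, [/\ is_cycle ends Z, e \in Z & Z :\ e \subset A].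
Proof.
move=> ee eA /connectP[p0 pp0 yE].
case/shortenP: pp0 yE => p pp up _ yE {p0}.
have [injE _] := hsimple.
have e_in f : f \in A -> ends f != ends e.
  by move=> fA; apply: contraNneq eA => /injE <-.
have xy := ends_neq ee.
have sz2 : 2 < size (x :: p).
  case: p pp up yE => [|z [|t p]] //=; first by move=> _ _ yE; rewrite yE eqxx in xy.
  case/andP=> /adjP[f fA fe] _ _ zE; have := e_in f fA.
  by rewrite fe ee zE eqxx.
have szV : size (x :: p) < #|V|.+1.
  by rewrite ltnS -(card_uniqP up) max_card.
(* The closing step from [y] to [x] runs along [e], outside [A], hence the extra disjunct. *)
have cr : cycle (fun a b => adj ends A a b || ((a == y) && (b == x))) (x :: p).
  rewrite /= rcons_path -yE !eqxx orbT andbT.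
  by apply: sub_path pp => a b ->.
exists [set f | [exists t in x :: p, ends f == [set t; next (x :: p) t]]]; split.
- apply/existsP; exists (Ordinal szV); apply/existsP; exists (in_tuple (x :: p)).
  rewrite sz2 up eqxx andbT /=; apply: sub_path cr => a b.
  case/orP=> [/adjP[f _ fe]|/andP[/eqP-> /eqP->]]; apply/adjP; first by exists f.
  by exists e => //; rewrite setUC.
- rewrite inE; apply/existsP; exists y; rewrite yE mem_last /= -yE.
  have := cycle_next up; rewrite (cycle_path x) /= -yE => /andP[/eqP-> _].
  by rewrite ee setUC.
- apply/subsetP=> f; rewrite !inE => /andP[fe /existsP[t /andP[tp /eqP ft]]].
  have := next_cycle cr tp; case/orP=> [/adjP[h hA he]|/andP[/eqP ty /eqP tx]].
    by have <- : h = f by apply: injE; rewrite he ft.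
  by case/eqP: fe; apply: injE; rewrite ft tx ty ee setUC.
Qed.

End Connectivity.

(** * Minimum weight spanning trees *)

Section Trees.
Variables (V : finType) (disp : Order.disp_t) (E : finOrderType disp).
Variable ends : E -> {set V}.
Hypothesis hsimple : simple_graph ends.
Hypothesis hconn : connected_subgraph ends [set: E].
Implicit Types (H T Z B A F : {set E}) (e f g : E) (u v x y : V).

Local Notation conn H := (connect (adj ends H)).

Lemma connectedP A : reflect (forall u v, conn A u v) (connected_subgraph ends A).
Proof. by apply: (iffP forallP) => h u; first move=> v; [apply/forallP | apply/forallP]. Qed.

Lemma connected_replace A A' g x y : connected_subgraph ends A ->
  ends g = [set x; y] -> A :\ g \subset A' -> conn A' x y ->
  connected_subgraph ends A'.
Proof.
move=> /connectedP cA ge sA cxy; apply/connectedP => u v.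
apply: connect_sub (cA u v) => a b /adjP[f fA fe].
have [fg|fg] := eqVneq f g.
  move: fe; rewrite fg ge => /set2_eq[][<- <-] //; by rewrite conn_sym.
by apply: conn_ends fe; apply: (subsetP sA); rewrite !inE fg.
Qed.

Lemma nbcP H : reflect (forall Z e, is_cycle ends Z -> e \in Z ->
    (forall f, f \in Z -> (e <= f)%O) -> ~~ (Z :\ e \subset H)) (nbc ends H).
Proof.
apply: (iffP idP) => [nH Z e cZ eZ emin|nH].
  apply: contra nH => sH; apply/existsP; exists (Z :\ e); rewrite sH andbT.
  apply/existsP; exists Z; rewrite cZ; apply/existsP; exists e; rewrite eZ eqxx andbT.
  by apply/forall_inP.
apply/existsP=> -[B /andP[/existsP[Z /andP[cZ /existsP[e /and3P[eZ /forall_inP emin /eqP->]]]]]].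
by apply/negP; apply: nH cZ eZ emin.
Qed.

Lemma nbcS H A : H \subset A -> nbc ends A -> nbc ends H.
Proof.
move=> sHA /nbcP nA; apply/nbcP => Z e cZ eZ emin.
by apply: contra (nA Z e cZ eZ emin) => /subset_trans; apply.
Qed.

(** An edge that is not a bridge lies on a cycle inside [H], and that cycle without its smallest
    edge is a broken circuit in [H]. *)
Lemma nbc_forest H : nbc ends H -> forest ends H.
Proof.
move=> /nbcP nH e x y eH ee; apply/negP => cxy.
have [|Z [cZ eZ sZ]] := conn_cycle hsimple ee _ cxy; first by rewrite !inE eqxx.
have sZH : Z \subset H.
  apply/subsetP=> f fZ; have [->//|fe] := eqVneq f e.
  by have := subsetP sZ f; rewrite !inE fe fZ => /(_ isT).
have [f fZ fmin] := Order.TotalTheory.arg_minP id eZ.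
by apply/negP: (nH Z f cZ fZ fmin); rewrite (subset_trans _ sZH) // subD1set.
Qed.

(** * Minimum weight connected sets and uniqueness of the tree *)

Definition edge_rank e : nat := #|[set f : E | (f < e)%O]|.

Definition weight A : nat := \sum_(e in A) (edge_rank e).+1.

Lemma edge_rank_lt e f : (e < f)%O -> edge_rank e < edge_rank f.
Proof.
move=> ef; apply/proper_card/properP; split.
  by apply/subsetP=> g; rewrite !inE => /Order.POrderTheory.lt_trans; apply.
by exists e; rewrite !inE ?ef // Order.POrderTheory.ltxx.
Qed.

Lemma weight_exchange A e g : g \in A -> (e < g)%O ->
  weight (e |: A :\ g) < weight A.
Proof.
move=> gA eg; rewrite /weight (big_setD1 g gA) /=.
have eg' := edge_rank_lt eg.
(* If [e] is already present, the exchange amounts to deleting [g], whose weight is positive. *)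
have [eA|eA] := boolP (e \in A :\ g).
  by have /setUidPr-> : [set e] \subset A :\ g; [rewrite sub1set | lia].
by rewrite big_setU1 //=; lia.
Qed.

(** Competitors need only be connected; when [H] is NBC, a minimizer is a forest because it is NBC
    as well. *)
Definition spans H A : bool := connected_subgraph ends A && (H \subset A).

Definition min_span H T : Prop :=
  spans H T /\ forall A, spans H A -> weight T <= weight A.

Definition tr H : {set E} := [arg min_(A < [set: E] | spans H A) weight A].

Lemma tr_min_span H : min_span H (tr H).
Proof. by rewrite /tr; case: arg_minnP => [|T sT mT]; first by rewrite /spans hconn subsetT. Qed.

(* If [T] contained a broken circuit [Z :\ e], an edge of it outside [H] could
   be traded for the smaller edge [e]. *)
Lemma min_span_nbc H T : nbc ends H -> min_span H T -> nbc ends T.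
Proof.
move=> /nbcP nH [/andP[cT sHT] mT]; apply/nbcP => Z e cZ eZ emin; apply/negP => sZT.
have /subsetPn[g gZ gH] := nH Z e cZ eZ emin.
have gT := subsetP sZT _ gZ; move: gZ; rewrite !inE => /andP[ge gZ].
have eg : (e < g)%O by rewrite Order.POrderTheory.lt_neqAle eq_sym ge emin.
have := weight_exchange gT eg; rewrite ltnNge mT //; apply/andP; split.
  have [x [y gxy]] := ends_pair hsimple g.
  apply: (connected_replace cT gxy (subsetUr _ _)).
  apply: connS (cycle_conn cZ gZ gxy); apply/subsetP=> f.
  rewrite !inE => /andP[fg fZ]; have [//|fe] := eqVneq f e.
  by have := subsetP sZT f; rewrite !inE fe fZ fg => /(_ isT).
apply/subsetP=> f fH; rewrite !inE (subsetP sHT) // andbT.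
by apply/orP; right; apply: contraNneq gH => <-.
Qed.

(** If some [f] in the cut of [e] were smaller than [e], replacing [e] by [f] would lower the weight
    while keeping the set connected and above [H]. *)
Lemma min_span_active H T e : min_span H T -> e \in T -> e \notin H ->
  ~~ internally_inactive ends T e.
Proof.
move=> [/andP[cT sHT] mT] eT eH; rewrite negbK; apply/forall_inP => f.
rewrite inE => /existsP[u /existsP[v /andP[/eqP fe ncut]]].
rewrite Order.TotalTheory.leNgt; apply/negP => lfe.
have := weight_exchange eT lfe; rewrite ltnNge mT //; apply/andP; split; last first.
  apply/subsetP=> g gH; rewrite !inE (subsetP sHT) // andbT.
  by apply/orP; right; apply: contraNneq eH => <-.
have [x [y ee]] := ends_pair hsimple e.
apply: (connected_replace cT ee (subsetUr _ _)).
have sT := subsetUr [set f] (T :\ e).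
have cuv : conn (f |: T :\ e) u v by apply: conn_ends fe; rewrite setU11.
(* The ends of [f] are joined in [T] only through [e], so in [T :\ e] they are joined to different
   ends of [e], and [f] reconnects these. *)
have := connectedP _ cT u v; rewrite -{1}(setD1K eT) (conn_setU1 _ _ _ ee) (negPf ncut) /=.
case/orP=> /andP[/(connS sT) c1 /(connS sT) c2].
  rewrite conn_sym in c1; rewrite conn_sym in c2.
  exact: connect_trans c1 (connect_trans cuv c2).
rewrite conn_sym in cuv; exact: connect_trans c2 (connect_trans cuv c1).
Qed.

(** Take [e] in [T] but not in [T']. The path of [T'] between its ends crosses the cut of [e] in [T]
    at an edge [g] whose own cut in [T'] contains [e]. Neither edge lies in [H], so both are active
    and each is at most the other, which forces [e = g]. *)
Lemma active_tree_sub H T T' :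
  connected_subgraph ends T' -> forest ends T -> forest ends T' ->
  H \subset T -> H \subset T' -> IN ends T \subset H -> IN ends T' \subset H ->
  T \subset T'.
Proof.
move=> /connectedP cT' fT fT' sT sT' iT iT'; apply/subsetP=> e eT.
have act A f g : f \in A -> f \notin H -> IN ends A \subset H -> g \in cut ends A f ->
    (f <= g)%O.
  move=> fA fH iA; have : f \notin IN ends A by apply: contra fH; apply: (subsetP iA).
  by rewrite inE fA /= negbK => /forall_inP; apply.
apply: contraT => eT'; have eH : e \notin H by apply: contra eT'; apply: (subsetP sT').
have [u [v ee]] := ends_pair hsimple e; have nce := fT e u v eT ee.
have ncut : ~~ conn (T' :\: cut ends T e) u v.
  apply: contra nce; apply: connect_sub => a b /adjP[f].
  rewrite !inE => /andP[fc _] fe; apply: contraT => nc; case/negP: fc.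
  by apply/existsP; exists a; apply/existsP; exists b; rewrite fe eqxx.
have [g [x [gT' gcut _ _ ncg]]] := forest_separating_edge fT' (cT' u v) ncut.
have ecut : e \in cut ends T' g.
  by rewrite inE; apply/existsP; exists u; apply/existsP; exists v; rewrite ee eqxx.
have gH : g \notin H.
  apply/negP => gH; move: gcut; rewrite inE => /existsP[a /existsP[b /andP[/eqP gab]]].
  apply/negP/negPn; apply: conn_ends gab; rewrite !inE (subsetP sT _ gH) andbT.
  by apply: contraNneq eT' => <-.
have eg : e = g.
  have le1 := act T e g eT eH iT gcut; have le2 := act T' g e gT' gH iT' ecut.
  by apply/eqP; rewrite Order.POrderTheory.eq_le le1 le2.
by rewrite eg gT' in eT'.
Qed.

Definition tree T : Prop := connected_subgraph ends T /\ forest ends T.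

Lemma min_span_tree H T : nbc ends H -> min_span H T ->
  [/\ tree T, nbc ends T, H \subset T & IN ends T \subset H].
Proof.
move=> nH mT; have nT := min_span_nbc nH mT; have [/andP[cT sT] _] := mT.
split=> //; first by split=> //; apply: nbc_forest.
apply/subsetP=> e; rewrite inE => /andP[eT]; apply: contraTT => eH.
exact: min_span_active mT eT eH.
Qed.

Lemma trP H : nbc ends H ->
  [/\ tree (tr H), nbc ends (tr H), H \subset tr H & IN ends (tr H) \subset H].
Proof. by move=> nH; apply: min_span_tree nH (tr_min_span H). Qed.

(** [active_tree_sub] applies in both directions; this is what makes the intervals from [IN T] to
    [T] disjoint. *)
Lemma tr_unique H T : nbc ends H -> tree T -> IN ends T \subset H -> H \subset T ->
  tr H = T.
Proof.
move=> /trP[[ctr ftr] _ str itr] [cT fT] iT sT.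
apply/eqP; rewrite eqEsubset.
by rewrite (active_tree_sub cT ftr fT str sT) // (active_tree_sub ctr fT ftr sT str).
Qed.

Lemma tr_weight_mono H A : H \subset A -> weight (tr H) <= weight (tr A).
Proof.
move=> sHA; apply: (tr_min_span H).2; have [/andP[cA sA] _] := tr_min_span A.
by rewrite /spans cA (subset_trans sHA).
Qed.

(** At equal weight [tr A] is also a minimizer for [H], so it falls under the uniqueness above. *)
Lemma tr_weight_eq H A : H \subset A -> nbc ends A -> weight (tr A) <= weight (tr H) ->
  tr H = tr A.
Proof.
move=> sHA nA wA; have nH := nbcS sHA nA.
have [/andP[cA sA] _] := tr_min_span A.
have mA : min_span H (tr A).
  split; first by rewrite /spans cA (subset_trans sHA).
  by move=> B sB; apply: leq_trans wA _; apply: (tr_min_span H).2.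
by have [tA _ sHtA iA] := min_span_tree nH mA; apply: tr_unique.
Qed.

(** * Rooted trees and the scanning order of their edges *)

Section Rooted.
Variable root : V.

(** For an edge [e] of a tree [T], this is the vertex set of the subtree hanging from [e]. *)
Definition below T e : {set V} := [set v | ~~ conn (T :\ e) root v].

(** The lower end of [e]; for an edge of a tree the default [root] is never returned. *)
Definition child T e : V := odflt root [pick x in ends e :&: below T e].

Lemma below_conn T A e u v : A \subset T :\ e -> conn A u v ->
  (u \in below T e) = (v \in below T e).
Proof.
move=> sA /(connS sA) c; rewrite !inE; congr (~~ _).
have sy := @conn_sym _ _ _ ends (T :\ e).
by rewrite !(sy root) (same_connect sy c).
Qed.

Lemma childP T e : tree T -> e \in T ->
  exists p, [/\ ends e = [set child T e; p], child T e \in below T e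
              & p \notin below T e].
Proof.
case=> /connectedP cT fT eT; have [x [y ee]] := ends_pair hsimple e.
have nxy := fT e x y eT ee.
have xor_b : (x \in below T e) = (y \notin below T e).
  rewrite !inE negbK; have [cx|ncx] /= := boolP (conn (T :\ e) root x).
    by apply/esym/negbTE; apply: contra nxy; apply: connect_trans; rewrite conn_sym.
  have := cT root y; rewrite -{1}(setD1K eT) (conn_setU1 _ _ _ ee) (negPf ncx) /=.
  by case/orP=> [->|/andP[->]].
rewrite /child; case: pickP => [z|none] /=.
  rewrite ee !in_setI !in_set2 => /andP[/orP[]/eqP-> zb]; rewrite zb.
    by exists y; rewrite -xor_b zb.
  by exists x; rewrite setUC xor_b zb.
have := none x; have := none y; rewrite ee !in_setI set21 set22 xor_b /= => ->.
by [].
Qed.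

Lemma child_uniq T e x : tree T -> e \in T -> x \in ends e -> x \in below T e ->
  x = child T e.
Proof.
move=> tT eT; have [p [-> _ pb]] := childP tT eT.
by rewrite in_set2 => /orP[/eqP//|/eqP->]; rewrite (negPf pb).
Qed.

(** Both ends of [f] lie in the subtree below [e]. Hence every vertex outside that subtree, and then
    the child of [e] through [e], is reached from the root without [f]. *)
Lemma below_lt T e f x : tree T -> e \in T -> f \in T -> f != e ->
  x \in ends f -> x \in below T e -> #|below T f| < #|below T e|.
Proof.
move=> tT eT fT fe xf xb.
have endsb a b : ends f = [set a; b] -> a \in below T e /\ b \in below T e.
  move=> fab; have : (a \in below T e) = (b \in below T e).
    by apply: (below_conn (subxx _)); apply: conn_ends fab; rewrite !inE fe.
  by move: xf; rewrite fab in_set2 => /orP[/eqP xa|/eqP xa]; rewrite -xa xb.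
have key v : v \notin below T e -> conn (T :\ e :\ f) root v.
  rewrite inE negbK => c.
  suff : v \notin below T e /\ conn (T :\ e :\ f) root v by case.
  apply: (conn_rect (P := fun v => v \notin below T e /\ conn (T :\ e :\ f) root v) c).
    by rewrite inE negbK connect0.
  move=> a b h hT hab [na ca]; have [hf|hf] := eqVneq h f.
    by subst h; have [aB _] := endsb _ _ hab; rewrite aB in na.
  split; first by rewrite -(below_conn (subxx _) (conn_ends hT hab)).
  by apply: connect_trans ca (conn_ends _ hab); rewrite in_setD1 hf.
have sub2 : T :\ e :\ f \subset T :\ f by rewrite setSD // subD1set.
have [p [ee cb pb]] := childP tT eT.
apply/proper_card/properP; split.
  apply/subsetP=> v vf; apply: contraTT vf => /key c.
  by rewrite inE negbK; apply: connS c.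
exists (child T e) => //; rewrite inE negbK.
apply: connect_trans (connS sub2 (key _ pb)) _; rewrite conn_sym.
by apply: conn_ends ee; rewrite !inE eq_sym fe.
Qed.

(** Subtree size decides first, so edges nearer the leaves come earlier; the enumeration rank,
    smaller than the factor [#|E|.+1], breaks ties and makes positions distinct. *)
Definition pos T e : nat := #|below T e| * #|E|.+1 + enum_rank e.

Lemma pos_inj T : injective (pos T).
Proof.
move=> e f /(congr1 (modn^~ #|E|.+1)); rewrite !modnMDl !modn_small;
  try by rewrite ltnS ltnW.
by move/val_inj/enum_rank_inj.
Qed.

Lemma pos_lt T e f : #|below T e| < #|below T f| -> pos T e < pos T f.
Proof.
move=> lt_ef; apply: leq_trans (leq_trans (leq_mul lt_ef (leqnn #|E|.+1)) _).
  by rewrite /pos mulSn addnC ltn_add2r ltnS ltnW.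
exact: leq_addr.
Qed.

(** Otherwise [e'] would touch the subtree below [e], so its own subtree would be smaller and its
    position earlier. *)
Lemma child_far T H e e' x y : tree T -> H \subset T -> e \in T -> e \notin H ->
  e' \in T -> pos T e < pos T e' -> ends e' = [set x; y] ->
  ~~ conn (e' |: H) x (child T e).
Proof.
move=> tT sH eT eH e'T lt_pos ee'; apply/negP => c.
have e'e : e' != e by apply: contraTneq lt_pos => ->; rewrite ltnn.
have sub : e' |: H \subset T :\ e.
  rewrite subUset sub1set !inE e'e e'T /=; apply/subsetP=> f fH.
  by rewrite !inE (subsetP sH) // andbT; apply: contraNneq eH => <-.
have [p [_ cb _]] := childP tT eT.
rewrite -(below_conn sub c) in cb.
have := below_lt tT eT e'T e'e _ cb; rewrite ee' set21 => /(_ isT)/pos_lt.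
by rewrite ltnNge ltnW.
Qed.

Lemma child_not_root T A f : tree T -> A \subset T -> f \in T :\: A ->
  ~~ conn A root (child T f).
Proof.
move=> tT sA /setDP[fT fA]; have [p [_ fb _]] := childP tT fT.
move: fb; rewrite inE; apply: contra; apply: connS; apply/subsetP=> k kA.
by rewrite !inE (subsetP sA) // andbT; apply: contraNneq fA => <-.
Qed.

(** An edge of [T] that leaves the component of [v] and separates [v] from the root has its lower
    end in that component. With [child_not_root], the components avoiding the root are exactly those
    of the children of the missing edges. *)
Lemma child_cover T A v : tree T -> A \subset T -> ~~ conn A root v ->
  exists2 f, f \in T :\: A & conn A (child T f) v.
Proof.
move=> tT sA ncv; have [/connectedP cT fT] := tT.
have TA : T :\: (T :\: A) = A by rewrite setDDr setDv set0U; apply/setIidPr.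
have [|g [x [gT gA xg cx ncg]]] := forest_separating_edge (F := T :\: A) fT (cT v root).
  by rewrite TA conn_sym.
rewrite TA in cx; exists g => //; rewrite conn_sym.
rewrite -(child_uniq tT gT xg) //.
have sub : A \subset T :\ g.
  apply/subsetP=> k kA; rewrite !inE (subsetP sA) // andbT.
  by apply: contraTneq gA => <-; rewrite inE kA.
by rewrite -(below_conn sub cx) inE conn_sym.
Qed.

End Rooted.
End Trees.

(** * Labels and the differential *)

(** Only the left exponent is bounded: for [j] at least [m] the right power is zero and differs from
    the left one, so comparing exponents also accounts for vanishing products. *)
Lemma xpow_eq (m i j : nat) : i < m -> (xpow m i == xpow m j) = (i == j).
Proof.
move=> lt_im; apply/eqP/eqP => [|-> //].
have m_gt0 : 0 < m by case: m lt_im.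
have szX k : k < m -> (size ('X^k : {poly int})%R < size (mk_monic ('X^m : {poly int})%R)).
  by move=> lt_km; rewrite mk_monic_Xn !size_polyXn prednK.
have xE k : xpow m k = in_qpoly ('X^m)%R ('X^k)%R by rewrite rmorphXn.
rewrite !xE => /(congr1 val) /=; rewrite Pdiv.CommonRing.rmodp_small ?szX //.
have [lt_jm|le_mj] := ltnP j m.
  rewrite Pdiv.CommonRing.rmodp_small ?szX // => /(congr1 (fun p : {poly int} => size p)).
  by rewrite !size_polyXn => -[].
rewrite -(subnK le_mj) exprD mk_monic_Xn prednK // Pdiv.RingMonic.rmodp_mull ?monicXn //.
by move/eqP; rewrite (negPf (monic_neq0 (monicXn _ _))).
Qed.

Section Labels.
Variables (V : finType) (disp : Order.disp_t) (E : finOrderType disp).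
Variable ends : E -> {set V}.
Variables (m : nat) (root : V).
Implicit Types (H A : {set E}) (e f : E) (u v x y : V) (s t : state ends m).

Local Notation conn H := (connect (adj ends H)).

Lemma comp_subproof H v : [set w | conn H v w] \in comps ends H.
Proof. exact: imset_f. Qed.

Definition component_of H v : component ends H :=
  exist (fun C => C \in comps ends H) _ (comp_subproof H v).

Lemma mem_comp H v w : (w \in val (component_of H v)) = conn H v w.
Proof. by rewrite /= inE. Qed.

Lemma compP H (C : component ends H) : exists v, C = component_of H v.
Proof. by have /imsetP[v _ vE] := valP C; exists v; apply: val_inj. Qed.

Lemma comp_eq H u v : (component_of H u == component_of H v) = conn H u v.
Proof.
apply/eqP/idP => [/(congr1 (fun C : component ends H => v \in val C))|c].
  by rewrite !mem_comp connect0.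
apply: val_inj; apply/setP=> w; rewrite !mem_comp.
exact: (same_connect (@conn_sym _ _ _ _ _) c).
Qed.

Lemma comp_sub H A u v : H \subset A ->
  (val (component_of H u) \subset val (component_of A v)) = conn A v u.
Proof.
move=> sHA; apply/subsetP/idP => [/(_ u)|c w]; rewrite !mem_comp.
  by rewrite connect0; apply.
by move=> /(connS sHA); apply: connect_trans.
Qed.

(** Labels are read on vertices instead of components, so that labellings over different edge sets
    can be compared without dependent types. *)
Definition lab s v : 'I_m := eps_of s (component_of (sub_of s) v).

Lemma lab_conn s u v : conn (sub_of s) u v -> lab s u = lab s v.
Proof. by rewrite -comp_eq /lab => /eqP->. Qed.

Lemma state_ext s t : sub_of s = sub_of t -> lab s =1 lab t -> s = t.
Proof.
case: s t => [H a] [A b] /= HA; move: HA a b => /= <- a b lab_eq.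
by congr Tagged; apply/ffunP => C; have [v ->] := compP C; apply: lab_eq.
Qed.

Definition vertex_of H (C : component ends H) : V := odflt root [pick v in val C].

Definition mk_state H (l : V -> 'I_m) : state ends m :=
  Tagged (fun H => {ffun component ends H -> 'I_m}) [ffun C : component ends H => l (vertex_of C)].

Lemma lab_mk_state H l v : (forall u w, conn H u w -> l u = l w) ->
  lab (mk_state H l) v = l v.
Proof.
move=> lc; rewrite /lab ffunE; apply/esym/lc; rewrite /vertex_of -mem_comp.
by case: pickP => [w //|/(_ v)]; rewrite /= inE connect0.
Qed.

Lemma enhanced_term_eq s e t :
  enhanced_term s e t = ((sub_of t == e |: sub_of s) &&
    [forall v, xpow m (lab t v) == (\prod_(C0 : component ends (sub_of s) |
       val C0 \subset val (component_of (e |: sub_of s) v)) xpow m (eps_of s C0))%R])%:R%R.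
Proof.
rewrite ffunE; congr ((nat_of_bool _)%:R)%R; apply/existsP/andP.
  by case=> l /andP[/eqP-> /forallP lE]; split=> //; apply/forallP => v; apply: lE.
case: t => [H l] [/eqP /= HE]; subst H => /forallP lE; exists l; rewrite eqxx /=.
by apply/forallP => C; have [v ->] := compP C; apply: lE.
Qed.

(** Exponents are added in [nat]; since [lab t v] is below [m], the equation itself rules out merges
    whose product vanishes. *)
Definition extends s e t : Prop :=
  [/\ e \notin sub_of s, sub_of t = e |: sub_of s &
    forall x y, ends e = [set x; y] -> forall v,
      lab t v = (if conn (sub_of t) x v then lab s x + lab s y else lab s v) :> nat].

Hypothesis hsimple : simple_graph ends.

Lemma conn_setU1_end e x y H v : ends e = [set x; y] ->
  conn (e |: H) x v = conn H x v || conn H y v.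
Proof.
move=> /(conn_setU1 H x v) ->.
by rewrite connect0; case: (conn H x v); rewrite ?andbF ?orbF.
Qed.

Lemma conn_setU1_far e x y H u v : ends e = [set x; y] -> ~~ conn (e |: H) x u ->
  conn (e |: H) u v = conn H u v.
Proof.
move=> ee; rewrite (conn_setU1_end _ _ ee) negb_or => /andP[nx ny].
by rewrite (conn_setU1 _ _ _ ee) !(@conn_sym _ _ _ _ _ u) (negPf nx) (negPf ny) /= orbF.
Qed.

Lemma merged_prod s e x y v : ends e = [set x; y] -> ~~ conn (sub_of s) x y ->
  (\prod_(C0 : component ends (sub_of s) | val C0 \subset val (component_of (e |: sub_of s) v))
     xpow m (eps_of s C0))%R =
  xpow m (if conn (e |: sub_of s) x v then lab s x + lab s y else lab s v).
Proof.
move=> ee nxy; set H := sub_of s in nxy *; set A := e |: H.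
have sHA : H \subset A by apply: subsetUr.
have [cv|ncv] := boolP (conn A x v).
  rewrite (bigD1 (component_of H x)) /=; last by rewrite comp_sub // conn_sym.
  rewrite (bigD1 (component_of H y)) /=; last first.
    rewrite comp_sub // eq_sym comp_eq nxy andbT conn_sym.
    by apply: connect_trans cv; rewrite conn_sym (conn_setU1_end _ _ ee) connect0 orbT.
  (* Besides the components of [x] and [y], none is contained in the merged one. *)
  rewrite big1 ?mulr1 /xpow ?exprD // => C /andP[/andP[]].
  have [u ->] := compP C; rewrite comp_sub // !comp_eq => cu.
  have : conn A x u by apply: connect_trans cv cu.
  by rewrite (conn_setU1_end _ _ ee) !(@conn_sym _ _ _ _ _ u) => /orP[]->.
rewrite (big_pred1 (component_of H v)) // => C /=; have [u ->] := compP C.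
by rewrite comp_sub // comp_eq (conn_setU1_far _ ee ncv) conn_sym.
Qed.

(** In a forest [e] joins two distinct components, so the case of an edge closing a cycle, where
    labels are kept, does not arise. *)
Lemma enhanced_term_neq0 s e t : forest ends (sub_of t) -> e \notin sub_of s ->
  enhanced_term s e t != 0%R <-> extends s e t.
Proof.
move=> ft es; rewrite enhanced_term_eq.
have nconn x y : sub_of t = e |: sub_of s -> ends e = [set x; y] ->
    ~~ conn (sub_of s) x y.
  move=> st ee; have := ft e x y; rewrite st setU11 => /(_ isT ee).
  by rewrite setU1K.
have [x [y ee]] := ends_pair hsimple e.
split=> [|[_ st lE]].
  case cE: (_ && _) => // _; have /andP[/eqP st /forallP lE] := cE.
  split=> // x' y' ee' v.
  have := lE v; rewrite (merged_prod _ ee') ?nconn // xpow_eq // -st.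
  by move/eqP.
case cE: (_ && _) => //; case/negP: (negbT cE).
rewrite st eqxx /=; apply/forallP => v; rewrite (merged_prod _ ee) ?nconn // xpow_eq // -st.
by rewrite (lE _ _ ee).
Qed.

Lemma chromatic_diff_eq s t : chromatic_diff s t =
  (\sum_(e | e \notin sub_of s) enhanced_term s e t *
     (-1) ^+ #|[set f in sub_of s | (f < e)%O]|)%R.
Proof.
rewrite /chromatic_diff sum_ffunE; apply: eq_bigr => e _.
rewrite -[in LHS]signr_odd -[in RHS]signr_odd.
by case: (odd _); rewrite ?expr0 ?expr1 ?mulr1 ?mulrN1z ?ffunE ?mulrN1 ?ffunE ?mulr1z.
Qed.

Lemma extends_uniq s e f t : extends s e t -> f \notin sub_of s ->
  sub_of t = f |: sub_of s -> f = e.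
Proof.
case=> es -> _ fs st; have : f \in e |: sub_of s by rewrite st setU11.
by rewrite !inE (negPf fs) orbF => /eqP.
Qed.

(** The edge leading from [s] to [t] is determined, so the coefficient is a sum with a single
    nonzero term, a sign. *)
Lemma chromatic_diff_extends s e t : forest ends (sub_of t) -> extends s e t ->
  chromatic_diff s t \is a GRing.unit.
Proof.
move=> ft st; have [es _ _] := st; rewrite chromatic_diff_eq (bigD1 e) //=.
rewrite [X in (_ + X)%R]big1 ?addr0.
  move/(enhanced_term_neq0 ft es): st; rewrite enhanced_term_eq.
  by case: (_ && _) => // _; rewrite mul1r unitrX.
move=> f /andP[fs fe]; have [->|nz] := eqVneq (enhanced_term s f t) 0%R; first by rewrite mul0r.
have [_ st' _] := (enhanced_term_neq0 ft fs).1 nz.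
by rewrite (extends_uniq st fs st') eqxx in fe.
Qed.

Lemma chromatic_diff_neq0 s t : forest ends (sub_of t) ->
  chromatic_diff s t != 0%R -> exists e, extends s e t.
Proof.
move=> ft; rewrite chromatic_diff_eq => nz.
have [e /andP[es ez]|none] := pickP (fun e => (e \notin sub_of s) && (enhanced_term s e t != 0%R)).
  by exists e; apply/enhanced_term_neq0.
rewrite big1 ?eqxx // in nz => e es.
by move: (none e); rewrite es /= => /eqP->; rewrite mul0r.
Qed.

End Labels.

(** * The matching *)

Section Matching.
Variables (V : finType) (disp : Order.disp_t) (E : finOrderType disp).
Variable ends : E -> {set V}.
Variables (m : nat) (root : V).
Hypothesis hsimple : simple_graph ends.
Hypothesis hconn : connected_subgraph ends [set: E].
Hypothesis hm : 0 < m.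
Implicit Types (H A T : {set E}) (e f : E) (u v x y : V) (s t a b : nbc_state ends m).

Local Notation conn H := (connect (adj ends H)).
Local Notation sub s := (sub_of (val s)).
Local Notation label s v := (nat_of_ord (lab (val s) v)).
Local Notation hrel := (hasse (@nbc_diff V disp E ends m)).

(** * Hits of a state and their behaviour when an edge is added *)

Definition state_tree s : {set E} := tr ends (sub s).

Definition active T : {set E} := T :\: IN ends T.

Lemma state_nbc s : nbc ends (sub s).
Proof. exact: (valP s). Qed.

Lemma state_treeP s :
  [/\ tree ends (state_tree s), nbc ends (state_tree s), sub s \subset state_tree s
    & IN ends (state_tree s) \subset sub s].
Proof. by have := trP hsimple hconn (state_nbc s); rewrite -/(state_tree s). Qed.

Lemma state_forest s : forest ends (sub s).
Proof. by have := nbc_forest hsimple (state_nbc s). Qed.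

Arguments state_forest : clear implicits.

Lemma hasseP a b : hrel a b <-> exists e, extends (val a) e (val b).
Proof.
rewrite /hasse /= ffunE; split=> [|[e ab]].
  exact (chromatic_diff_neq0 hsimple (state_forest b)).
apply: contraTneq (chromatic_diff_extends hsimple (state_forest b) ab) => ->.
by rewrite unitr0.
Qed.

Lemma hasse_unit a b : hrel a b -> nbc_diff a b \is a GRing.unit.
Proof.
case/hasseP=> e ab; rewrite ffunE.
exact (chromatic_diff_extends hsimple (state_forest b) ab).
Qed.

(** Exponent [0] stands for the label 1. Only active edges are scanned, so adding or removing a hit
    stays in the same interval. *)
Definition hit s e : bool :=
  (e \in active (state_tree s)) &&
  ((e \in sub s) || (label s (child ends root (state_tree s) e) == 0)).

Definition first s e : bool := hit s e &&
  [forall f, hit s f ==> (pos ends root (state_tree s) e <= pos ends root (state_tree s) f)].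

Lemma firstP s e : reflect (hit s e /\ forall f, hit s f ->
  pos ends root (state_tree s) e <= pos ends root (state_tree s) f) (first s e).
Proof.
apply: (iffP andP) => -[he]; first by move/forallP=> h; split=> // f; apply/implyP.
by move=> h; split=> //; apply/forallP => f; apply/implyP; apply: h.
Qed.

Lemma first_uniq s e f : first s e -> first s f -> e = f.
Proof.
move=> /firstP[he me] /firstP[hf mf]; apply: (@pos_inj _ _ _ ends root (state_tree s)).
by apply/eqP; rewrite eqn_leq me ?mf.
Qed.

Lemma first_ex s f : hit s f -> exists e, first s e.
Proof.
move=> hf; exists [arg min_(e < f | hit s e) pos ends root (state_tree s) e].
by case: arg_minnP => // e he me; apply/firstP.
Qed.

Lemma extends_sub a e b : extends (val a) e (val b) -> sub a \subset sub b.
Proof. by case=> _ -> _; apply: subsetUr. Qed.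

Lemma extends_active a e b : extends (val a) e (val b) -> state_tree a = state_tree b ->
  e \in active (state_tree a).
Proof.
case=> ea sb _ Tab; have [_ _ _ iT] := state_treeP a; have [_ _ sT _] := state_treeP b.
rewrite inE Tab (subsetP sT) ?sb ?setU11 // andbT -Tab.
by apply: contra ea; apply: (subsetP iT).
Qed.

Lemma extends_tree_up a e b : extends (val a) e (val b) ->
  e \in active (state_tree a) -> state_tree a = state_tree b.
Proof.
move=> ab /setDP[eT _]; have [tT nT sT iT] := state_treeP a; have [ea sb _] := ab.
apply/esym; apply: (tr_unique hsimple hconn (state_nbc b)) => //.
  exact: subset_trans iT (extends_sub ab).
by rewrite sb subUset sub1set eT.
Qed.

Lemma extends_tree_down a e b : extends (val a) e (val b) ->
  e \in active (state_tree b) -> state_tree a = state_tree b.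
Proof.
move=> ab /setDP[eT eI]; have [tT nT sT iT] := state_treeP b; have [ea sb _] := ab.
apply: (tr_unique hsimple hconn (state_nbc a)) => //; last first.
  exact: subset_trans (extends_sub ab) sT.
apply/subsetP=> f fI; have := subsetP iT _ fI; rewrite sb => /setU1P[fe|//].
by rewrite -fe fI in eI.
Qed.

Section Step.
Variables (a b : nbc_state ends m) (e : E).
Hypotheses (ab : extends (val a) e (val b)) (Tab : state_tree a = state_tree b).

(** An edge scanned before [e] keeps its membership and, if absent, the label of its lower
    component, which [e] does not touch by [child_far]. *)
Lemma step_hit f : pos ends root (state_tree a) f < pos ends root (state_tree a) e ->
  hit b f = hit a f.
Proof.
move=> lt_fe; rewrite /hit -Tab.
have [fT|//] := boolP (f \in active _); rewrite !andTb.
have [tT _ sT _] := state_treeP a; have [ea sb lE] := ab.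
have fe : f != e by apply: contraTneq lt_fe => ->; rewrite ltnn.
rewrite sb !inE (negPf fe) /=; case: (boolP (f \in sub a)) => //= fa.
have [x [y ee]] := ends_pair hsimple e.
have [[eT _] [fT' _]] := (setDP (extends_active ab Tab), setDP fT).
by rewrite (lE _ _ ee) sb (negPf (child_far hsimple tT sT fT' fa eT lt_fe ee)).
Qed.

Lemma step_hit_new : hit b e.
Proof.
have [_ sb _] := ab.
by rewrite /hit -Tab (extends_active ab Tab) sb setU11.
Qed.

Lemma step_first_old f : first a f ->
  pos ends root (state_tree a) f < pos ends root (state_tree a) e -> first b f.
Proof.
move=> /firstP[hf mf] lt_fe; apply/firstP; split; first by rewrite step_hit.
move=> g hg; rewrite -Tab leqNgt; apply/negP => lt_gf.
have hg' : hit a g by rewrite -step_hit // (ltn_trans lt_gf).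
by have := mf g hg'; rewrite leqNgt lt_gf.
Qed.

(** Once added, [e] is a hit whatever the label of its child was, and by [step_hit] no earlier hit
    is created. *)
Lemma step_first_new : (forall f, hit a f ->
  pos ends root (state_tree a) e <= pos ends root (state_tree a) f) -> first b e.
Proof.
move=> mf; apply/firstP; split=> [|g hg]; first exact: step_hit_new.
rewrite -Tab leqNgt; apply/negP => lt_gf.
have hg' : hit a g by rewrite -step_hit.
by have := mf g hg'; rewrite leqNgt lt_gf.
Qed.

End Step.

(** * The matching, its partners and its critical states *)

Definition matching : {set nbc_state ends m * nbc_state ends m} :=
  [set p | hrel p.1 p.2 &&
    [exists e, [&& first p.1 e, e \notin sub p.1 & sub p.2 == e |: sub p.1]]].

Lemma matchingP a b :
  (a, b) \in matching <-> exists2 e, extends (val a) e (val b) & first a e.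
Proof.
rewrite inE /=; split=> [/andP[/hasseP[e ab] /existsP[f /and3P[ff fa /eqP sb]]]|[e ab fe]].
  by exists e => //; rewrite -(extends_uniq ab fa sb).
apply/andP; split; first by apply/hasseP; exists e.
by have [ea sb _] := ab; apply/existsP; exists e; rewrite fe ea sb eqxx.
Qed.

Lemma matching_first a b : (a, b) \in matching ->
  exists e, [/\ extends (val a) e (val b), first a e, first b e & state_tree a = state_tree b].
Proof.
case/matchingP=> e ab fa; have [he me] := firstP _ _ fa.
have Tab : state_tree a = state_tree b by apply: extends_tree_up ab _; case/andP: he.
exists e; split; [exact: ab | exact: fa | exact: (step_first_new ab Tab me) | exact: Tab].
Qed.

Lemma up_partner a e : first a e -> e \notin sub a -> exists b, extends (val a) e (val b).
Proof.
move=> /firstP[/andP[eact]] + _ ea; rewrite (negPf ea) /= => /eqP l0.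
have [tT nT sT iT] := state_treeP a; have [eT eI] := setDP eact.
have [p [ee _ _]] := childP hsimple root tT eT.
set c := child _ _ _ _ in l0 ee; set A := e |: sub a.
have sA : A \subset state_tree a by rewrite subUset sub1set eT.
(* The component of the child is labelled 1, so the merged component takes the label of the upper
   end [p]. *)
pose l v := if conn A c v then lab (val a) p else lab (val a) v.
have lc u w : conn A u w -> l u = l w.
  move=> uw; rewrite /l -(same_connect_r (@conn_sym _ _ _ ends A) uw).
  case: ifPn => // ncu; apply: lab_conn.
  by rewrite -(conn_setU1_far _ ee ncu).
have nA : nbc ends (sub_of (mk_state ends root A l)) by apply: nbcS sA nT.
exists (exist (fun r : state ends m => is_true (nbc ends (sub_of r))) _ nA); split=> //= x y ee' v.
rewrite lab_mk_state // /l.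
move: ee'; rewrite ee => /set2_eq[][<- <-]; first by case: ifP => // _; rewrite l0.
have -> : connect (adj ends A) p v = conn A c v.
  apply: (same_connect (@conn_sym _ _ _ ends A)); rewrite conn_sym.
  by apply: conn_ends ee; rewrite setU11.
by case: ifP => // _; rewrite l0 addn0.
Qed.

Lemma down_partner b e : first b e -> e \in sub b ->
  exists a, extends (val a) e (val b) /\ first a e.
Proof.
move=> fb eb; have [/andP[eact _] mb] := firstP _ _ fb.
have [tT nT sT iT] := state_treeP b; have [eT eI] := setDP eact.
have [p [ee _ _]] := childP hsimple root tT eT.
set c := child _ _ _ _ in ee; set A := sub b :\ e.
have AE : sub b = e |: A by rewrite setD1K.
have ncp : ~~ conn A c p by apply: (state_forest b) eb ee.
(* [Ordinal hm] is the exponent [0]: the lower component gets the label 1 and the upper one keeps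
   the label of the whole, so the product is unchanged. *)
pose l v := if conn A c v then Ordinal hm else lab (val b) v.
have lc u w : conn A u w -> l u = l w.
  move=> uw; rewrite /l -(same_connect_r (@conn_sym _ _ _ ends A) uw).
  by case: ifPn => // ncu; apply: lab_conn; apply: connS uw; apply: subD1set.
have nA : nbc ends (sub_of (mk_state ends root A l)) by apply: nbcS (state_nbc b); rewrite subD1set.
pose a : nbc_state ends m := exist (fun r : state ends m => is_true (nbc ends (sub_of r))) _ nA.
have ab : extends (val a) e (val b).
  split=> //=; first by rewrite !inE eqxx.
  have lE v : label b v = (if conn (sub b) c v then l c + l p else l v).
    rewrite /l connect0 (negPf ncp) add0n AE (conn_setU1_end _ _ ee).
    case: ifP => [cv|/norP[/negPf->//]].
    have ee2 : ends e = [set p; c] by rewrite setUC.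
    have pv : conn (sub b) p v by rewrite AE (conn_setU1_end _ _ ee2) orbC.
    by rewrite (lab_conn pv).
  move=> x y ee' v; rewrite !lab_mk_state // lE.
  move: ee'; rewrite ee => /set2_eq[][<- <-] //.
  have -> : conn (sub b) p v = conn (sub b) c v.
    apply: (same_connect (@conn_sym _ _ _ ends (sub b))); rewrite conn_sym.
    exact: conn_ends ee.
  by rewrite addnC.
have Tab : state_tree a = state_tree b by apply: extends_tree_down ab eact.
exists a; split; first exact: ab.
apply/firstP; split.
  rewrite /hit Tab eact /=; apply/orP; right.
  by rewrite -/c lab_mk_state // /l connect0.
move=> f hf; rewrite leqNgt; apply/negP => lt_fe.
have := mb f; rewrite -Tab leqNgt lt_fe (step_hit ab Tab lt_fe) hf.
by move/(_ isT).
Qed.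

(** A state with a hit has a partner along its first one, downwards if that edge is present and
    upwards otherwise; conversely both ends of a matched pair have a hit. *)
Lemma criticalP s : critical matching s <-> forall e, ~~ hit s e.
Proof.
split=> [/forall_inP cs e|nh].
  apply/negP => he; have [f ff] := first_ex he.
  have [fs|fs] := boolP (f \in sub s).
    have [a [ab fa]] := down_partner ff fs.
    have /cs : (a, s) \in matching by apply/matchingP; exists f.
    by rewrite /= eqxx andbF.
  have [b ab] := up_partner ff fs.
  have /cs : (s, b) \in matching by apply/matchingP; exists f.
  by rewrite /= eqxx.
apply/forall_inP => -[a b] /matching_first[e [_ /firstP[ha _] /firstP[hb _] _]].
by apply/andP; split=> /=; apply: contraTneq isT => sE; case/negP: (nh e); rewrite sE.
Qed.

Lemma extends_fun a e b b' : extends (val a) e (val b) -> extends (val a) e (val b') ->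
  b = b'.
Proof.
move=> [_ sb lb] [_ sb' lb']; apply/val_inj/state_ext; first by rewrite sb.
move=> v; have [x [y ee]] := ends_pair hsimple e; apply: val_inj.
by rewrite /= (lb _ _ ee) (lb' _ _ ee) sb sb'.
Qed.

(** The added edge is the first hit of [b], hence determined, and the lower labels are recovered
    from [b]: exponent [0] on the component of the child, those of [b] elsewhere. *)
Lemma matching_inj_l a a' b : (a, b) \in matching -> (a', b) \in matching -> a = a'.
Proof.
move=> /matching_first[e [ab fa fb Tab]] /matching_first[e' [ab' fa' fb' Tab']].
have ee' := first_uniq fb fb'; subst e'.
have [[ea sb lb] [ea' sb' lb']] := (ab, ab').
have [sa sa'] : sub a = sub b :\ e /\ sub a' = sub b :\ e.
  by rewrite {1}sb sb' !setU1K.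
have zero s : first s e -> e \notin sub s -> state_tree s = state_tree b ->
    label s (child ends root (state_tree b) e) = 0.
  by move=> /firstP[/andP[_]] + _ es Ts; rewrite (negPf es) Ts /= => /eqP.
have [l0 l0'] := (zero _ fa ea Tab, zero _ fa' ea' Tab').
have [/andP[/setDP[eT _] _] _] := firstP _ _ fb.
have [tT _ _ _] := state_treeP b; have [p [ee _ _]] := childP hsimple root tT eT.
set c := child _ _ _ _ in l0 l0' ee.
apply/val_inj/state_ext; first by rewrite sa sa'.
move=> v; apply: val_inj => /=.
have lE s : sub s = sub b :\ e -> label s c = 0 -> sub b = e |: sub s ->
   (forall v, label b v = if conn (sub b) c v then label s c + label s p else label s v) ->
   label s v = if conn (sub b :\ e) c v then 0 else label b v.
  move=> sE s0 bE ->; case: ifPn => [cv|ncv].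
    by rewrite -s0; congr nat_of_ord; apply/esym/lab_conn; rewrite sE.
  rewrite s0 bE (conn_setU1_end _ _ ee) sE (negPf ncv) /=.
  by case: ifP => // pv; congr nat_of_ord; apply/esym/lab_conn; rewrite sE.
by rewrite (lE a) ?(lE a') // => w; [apply: lb' ee _ | apply: lb ee _].
Qed.

Lemma matching_is_matching : is_matching (@nbc_diff V disp E ends m) matching.
Proof.
split=> [[a b]|[a b] [a' b'] Mab Mab' pq]; first by rewrite inE => /andP[].
(* If a state were the lower end of one matched pair and the upper end of another, its first hit
   would be both absent from it and present in it. *)
have mixed c d c' : (c, d) \in matching -> (c', c) \in matching -> False.
  move=> /matching_first[e [[ea _ _] fe _ _]] /matching_first[f [[_ sf _] _ ff _]].
  by rewrite (first_uniq fe ff) sf setU11 in ea.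
rewrite disjoints_subset /=; apply/subsetP => z; rewrite !inE => zab.
apply/negP => zab'; case/orP: zab zab' => /eqP-> /orP[]/eqP E1.
- case/eqP: pq; rewrite -E1 in Mab' *; congr (_, _).
  have [e ab fe] := (matchingP a b).1 Mab; have [e' ab' fe'] := (matchingP a b').1 Mab'.
  by rewrite -(first_uniq fe fe') in ab'; apply: extends_fun ab ab'.
- by rewrite -E1 in Mab'; apply: mixed Mab Mab'.
- by rewrite -E1 in Mab'; apply: mixed Mab' Mab.
- by case/eqP: pq; rewrite -E1 in Mab' *; rewrite (matching_inj_l Mab Mab').
Qed.

(** * Acyclicity through a potential *)

Definition first_pos s : nat :=
  if [pick e | first s e] is Some e then pos ends root (state_tree s) e
  else (\max_e pos ends root (state_tree s) e).+1.

Definition first_in s : bool := [exists e, first s e && (e \in sub s)].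

Lemma first_posE s e : first s e -> first_pos s = pos ends root (state_tree s) e.
Proof.
rewrite /first_pos => fe; case: pickP => [f ff|/(_ e)]; last by rewrite fe.
by rewrite (first_uniq fe ff).
Qed.

Lemma first_inE s e : first s e -> first_in s = (e \in sub s).
Proof.
move=> fe; apply/existsP/idP => [[f /andP[ff]]|es]; first by rewrite (first_uniq fe ff).
by exists e; rewrite fe.
Qed.

(* Every step of the reversed Hasse diagram is strictly increasing for the
   lexicographic order on (weight of the tree, minus the position of the first
   hit, absence of the first hit, number of edges). *)
Definition potential_lt : rel (nbc_state ends m) := [rel a b |
  (weight (state_tree a) < weight (state_tree b)) ||
  ((weight (state_tree a) == weight (state_tree b)) &&
   ((first_pos b < first_pos a) ||
    ((first_pos a == first_pos b) &&
     ((first_in b < first_in a) ||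
      ((first_in a == first_in b) && (#|sub a| < #|sub b|))))))].

Lemma potential_lt_trans : transitive potential_lt.
Proof.
move=> b a c; rewrite /potential_lt /=.
move: (weight _) (weight _) (weight _) (first_pos a) (first_pos b) (first_pos c)
  (#|_|) (#|_|) (#|_|) (first_in a) (first_in b) (first_in c).
by move=> w1 w2 w3 p1 p2 p3 n1 n2 n3 [] [] []; lia.
Qed.

Lemma potential_lt_irr a : potential_lt a a = false.
Proof. by rewrite /potential_lt /= !ltnn !andbF. Qed.

(** A reversed matched edge keeps the tree and the first hit but removes that hit from the state. An
    unmatched step adding [e] raises the weight or keeps the tree. In the latter case either the
    first hit precedes [e] and survives while the number of edges grows, or [e] becomes an earlier
    first hit. *)
Lemma reversed_potential a b : reversed_hasse (@nbc_diff V disp E ends m) matching a b ->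
  potential_lt a b.
Proof.
case/orP=> [/andP[/hasseP[e ab] nM]|/matching_first[e [[eb sa _] fb fa Tba]]]; last first.
  rewrite /potential_lt /= -Tba eqxx (first_posE fb) (first_posE fa) Tba eqxx.
  by rewrite (first_inE fb) (first_inE fa) (negPf eb) sa setU11 /= !orbT.
have le_w := tr_weight_mono hconn (extends_sub ab).
have [lt_w|ge_w] := ltnP (weight (state_tree a)) (weight (state_tree b)).
  by rewrite /potential_lt /= lt_w.
have Tab := tr_weight_eq hsimple hconn (extends_sub ab) (state_nbc b) ge_w.
rewrite -/(state_tree a) -/(state_tree b) in Tab.
rewrite /potential_lt /= Tab eqxx ltnn /=.
have [f ff|none] := pickP (first a); last first.
  have nh f : ~~ hit a f by apply/negP => /first_ex[g]; rewrite none.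
  have fb : first b e.
    by apply: (step_first_new ab Tab) => f hf; rewrite (negPf (nh f)) in hf.
  (* A state without hits has [first_pos] one above all positions in its tree, so acquiring a hit
     lowers it. *)
  rewrite (first_posE fb) /first_pos; case: pickP => [g|_]; first by rewrite none.
  by rewrite Tab ltnS leq_bigmax.
have [hf mf] := firstP _ _ ff.
have [lt_fe|lt_ef|eq_ef] := ltngtP (pos ends root (state_tree a) f) (pos ends root (state_tree a) e).
- have fb := step_first_old ab Tab ff lt_fe.
  have fe : f != e by apply: contraTneq lt_fe => ->; rewrite ltnn.
  have [ea sb _] := ab.
  rewrite (first_posE ff) (first_posE fb) (first_inE ff) (first_inE fb) Tab eqxx.
  by rewrite sb in_setU1 (negPf fe) eqxx cardsU1 ea add1n ltnS leqnn !orbT.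
- have fb : first b e.
    by apply: (step_first_new ab Tab) => g hg; apply: leq_trans (ltnW lt_ef) (mf g hg).
  by rewrite (first_posE ff) (first_posE fb) -Tab lt_ef.
- case/negP: nM; apply/matchingP; exists e => //.
  by rewrite -(pos_inj eq_ef).
Qed.

Lemma matching_acyclic : acyclic_matching (@nbc_diff V disp E ends m) matching.
Proof.
split; first exact: matching_is_matching.
  by move=> [a b]; rewrite inE => /andP[/hasse_unit].
case=> [//|x c] _; apply/negP => /=.
move/(sub_path reversed_potential)/(order_path_min potential_lt_trans)/allP/(_ x).
by rewrite mem_rcons mem_head potential_lt_irr => /(_ isT).
Qed.

(** * Counting the critical states of an interval *)

Lemma critical_interval T : tree ends T -> nbc ends T ->
  #|[set s : nbc_state ends m | [&& critical matching s,
      IN ends T \subset sub s & sub s \subset T]]|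
  = m * (m - 1) ^ (#|comps ends (IN ends T)| - 1).
Proof.
move=> tT nT; set I := IN ends T.
have sIT : I \subset T by apply/subsetP=> e; rewrite inE => /andP[].
pose C0 := component_of ends I root.
(* These are the admissible exponents: only the component of the root may carry [0]. *)
pose F (C : component ends I) : pred 'I_m :=
  fun k => (C == C0) || (nat_of_ord k != 0).
pose tag_I (l : {ffun component ends I -> 'I_m}) : state ends m :=
  Tagged (fun H => {ffun component ends H -> 'I_m}) l.
have nI l : nbc ends (sub_of (tag_I l)) by apply: nbcS sIT nT.
pose g l : nbc_state ends m :=
  exist (fun r : state ends m => is_true (nbc ends (sub_of r))) (tag_I l) (nI l).
have g_inj : injective g.
  by move=> l l' /(congr1 val)/eqP; rewrite eq_Tagged => /eqP.
have interval s : I \subset sub s -> sub s \subset T -> state_tree s = T.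
  by move=> sI sT; apply: (tr_unique hsimple hconn (state_nbc s)) => //.
transitivity #|[set g l | l in family F]|.
  apply: eq_card => s; rewrite inE; apply/and3P/imsetP.
    case=> /criticalP nh sI sT; have Ts := interval s sI sT.
    (* Any further edge of the state would be active and present, hence a hit. *)
    have sE : sub s = I.
      apply/eqP; rewrite eqEsubset sI andbT; apply/subsetP=> e es.
      apply: contraNT (nh e) => eI; rewrite /hit Ts es andbT.
      by rewrite inE eI (subsetP sT).
    have [l lE] : exists l, val s = tag_I l.
      by case: (val s) sE => H l /= HE; move: HE l => -> l; exists l.
    have sg : s = g l by apply: val_inj.
    exists l => //; apply/familyP => C; have [v ->] := compP C.
    rewrite unfold_in /F comp_eq; case: (boolP (conn I v root)) => //= ncv.
    (* A component avoiding the root contains the child of an absent active edge; as this edge is no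
       hit, the exponent is nonzero. *)
    have [|f fT cf] := child_cover (v := v) hsimple (root := root) tT sIT.
      by rewrite conn_sym.
    have := nh f; rewrite /hit Ts /active fT sE /=.
    have -> : f \in I = false by apply/negbTE; case/setDP: fT.
    by rewrite /= lE /lab /=; move: cf; rewrite -comp_eq => /eqP <-.
  case=> l /familyP lF ->.
  have Ts := interval (g l) (subxx _) sIT.
  split=> //; apply/criticalP => e; rewrite /hit Ts.
  have [eT|//] := boolP (e \in active T); rewrite andTb.
  have -> : (e \in sub (g l)) = false by apply/negbTE; case/setDP: eT.
  (* Conversely, the child of an absent active edge lies outside the component of the root, so its
     exponent is nonzero and the edge is no hit. *)
  have := lF (component_of ends I (child ends root T e)); rewrite unfold_in /F comp_eq.
  by rewrite conn_sym (negPf (child_not_root hsimple root tT sIT eT)).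
rewrite card_imset // card_family foldrE big_map big_enum /=.
have m1 : #|fun k : 'I_m => nat_of_ord k != 0| = m - 1.
  rewrite subn1 -[in RHS](card_ord m) -(cardC1 (Ordinal hm)); apply: eq_card => k.
  by rewrite !inE.
rewrite (bigD1 C0) //=; congr (_ * _).
  by rewrite -[RHS]card_ord; apply: eq_card => k; rewrite unfold_in /F eqxx.
transitivity (\prod_(C | C != C0) (m - 1)).
  apply: eq_bigr => C CC0; rewrite -m1; apply: eq_card => k.
  by rewrite unfold_in /F (negPf CC0).
rewrite prod_nat_const cardC1 card_sig !subn1; congr (_ ^ _.-1); exact: eq_card.
Qed.

End Matching.

Theorem theorem4p1 (V : finType) (disp : Order.disp_t) (E : finOrderType disp)
    (ends : E -> {set V}) (root : V) (m : nat)
    (hsimple : simple_graph ends)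
    (hconn : connected_subgraph ends [set: E])
    (hm : 2 <= m) :
  exists M : {set nbc_state ends m * nbc_state ends m},
    acyclic_matching (@nbc_diff V disp E ends m) M /\
    forall T : {set E}, nbc_spanning_tree ends T ->
      #|[set s : nbc_state ends m |
           [&& critical M s, IN ends T \subset sub_of (val s)
             & sub_of (val s) \subset T]]|
      = m * (m - 1) ^ (#|comps ends (IN ends T)| - 1).
Proof.
have m_gt0 : 0 < m := ltnW hm.
exists (matching ends m root); split; first exact: matching_acyclic.
move=> T /andP[stT nT]; apply: critical_interval => //.
by split; [case/andP: stT | apply: nbc_forest].
Qed.
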